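(* For every $\alpha\in(0,1)$ there is a constant $C(\alpha)$ such that the following holds. Let $r>0$, $R>0$, and let $\mathcal{J}$ be a family of $n\times n$ interaction matrices such that: (1) for all $J\in\mathcal{J}$ the infinity norm of $J$ is bounded by $1-\alpha$, and the diameter of $\mathcal{J}$ is bounded by $R$, i.e. $\|A-B\|_F\le R$ for all $A,B\in\mathcal{J}$; and (2) $$\frac{\log N(\mathcal{J},\|\cdot\|_F,2r)}{2}\ge C(\alpha)R^2+\log2.$$ Then any estimator $\hat J(x)$ based on a single sample $x$ satisfies $$\sup_{J^*\in\mathcal{J}}\mathbb{E}_{x\sim\Pr_{J^*}}\big[\|\hat J(x)-J^*\|_F\big]\ge r/2.$$
   Context: An interaction matrix is a real symmetric $n\times n$ matrix $J$ with zero diagonal. The Ising model $\Pr_J$ is the distribution on $\{\pm1\}^n$ with $\Pr_J[x]\propto\exp(x^\top Jx/2)$. $\|J\|_\infty=\max_i\sum_j|J_{ij}|$ and $\|\cdot\|_F$ is the Frobenius norm. An $\epsilon$-cover of $\mathcal{V}$ is a set $\mathcal{N}\subseteq\mathcal{V}$ such that every $v\in\mathcal{V}$ has some $u\in\mathcal{N}$ with $\|u-v\|\le\epsilon$; $N(\mathcal{V},\|\cdot\|,\epsilon)$ is the minimum cardinality of an $\epsilon$-cover. An estimator is any function from $\{\pm1\}^n$ to $\mathbb{R}^{n\times n}$. *)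

(* Defs.v *)
From HB Require Import structures.
From mathcomp Require Import all_boot all_order all_algebra.
From mathcomp Require Import all_classical all_reals all_analysis.
Set Implicit Arguments.
Unset Strict Implicit.
Unset Printing Implicit Defensive.
Import Order.TTheory GRing.Theory Num.Theory.
Local Open Scope classical_set_scope.
Local Open Scope card_scope.
Local Open Scope ring_scope.

Definition interaction_matrix (R : realType) (n : nat) (J : 'M[R]_n) : Prop :=
  J^T = J /\ forall i, J i i = 0.

Definition norm_inf (R : realType) (n : nat) (J : 'M[R]_n) : R :=
  \big[Num.max/0]_(i < n) \sum_(j < n) `|J i j|.

Definition norm_F (R : realType) (n : nat) (A : 'M[R]_n) : R :=
  Num.sqrt (\sum_(i < n) \sum_(j < n) A i j ^+ 2).

(* The points of {+1, -1}^n are encoded by {ffun 'I_n -> bool}, where [false]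
   stands for +1 and [true] for -1. *)
Definition spins (R : realType) (n : nat) (x : {ffun 'I_n -> bool}) : 'cV[R]_n :=
  \col_i (-1) ^+ x i.

Definition ising_weight (R : realType) (n : nat) (J : 'M[R]_n)
    (x : {ffun 'I_n -> bool}) : R :=
  expR (((spins R x)^T *m J *m spins R x) 0 0 / 2).

Definition ising_prob (R : realType) (n : nat) (J : 'M[R]_n)
    (x : {ffun 'I_n -> bool}) : R :=
  ising_weight J x / \sum_(y : {ffun 'I_n -> bool}) ising_weight J y.

Definition ising_expectation (R : realType) (n : nat) (J : 'M[R]_n)
    (f : {ffun 'I_n -> bool} -> R) : R :=
  \sum_(x : {ffun 'I_n -> bool}) ising_prob J x * f x.

Definition is_cover (R : realType) (V : zmodType) (A : set V) (nrm : V -> R)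
    (eps : R) (N : set V) : Prop :=
  N `<=` A /\ forall v, A v -> exists2 u, N u & nrm (u - v) <= eps.

(* The infimum of an empty set is +oo: this is the value when there is no
   finite cover. *)
Definition covering_number (R : realType) (V : zmodType) (A : set V)
    (nrm : V -> R) (eps : R) : \bar R :=
  ereal_inf [set k%:R%:E | k in
    [set k : nat | exists2 N : set V, is_cover A nrm eps N & N #= `I_k]].

(* Main.v *)
Require Import Defs.
From HB Require Import structures.
From mathcomp Require Import all_boot all_order all_algebra.
From mathcomp Require Import all_classical all_reals all_analysis.
From mathcomp Require Import ring lra.
Import Order.TTheory GRing.Theory Num.Theory.
Import numFieldNormedType.Exports.
Set Implicit Arguments.
Unset Strict Implicit.
Unset Printing Implicit Defensive.
Local Open Scope classical_set_scope.
Local Open Scope ring_scope.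

(** The argument is Fano's method. As [F] has no [2 r]-cover with fewer than
[exp (2 (C D^2 + ln 2))] elements, it contains that many matrices at pairwise
distance more than [2 r] ([separated_family]). An estimator can be within [r]
of at most one of them, and Fano's inequality ([fano]) says that one sample
identifies the right one with probability at most 1/2, as soon as the
Kullback-Leibler divergence between any two of the models is at most [C D^2].
So, on average over the models, the error is at least [r] with probability at
least 1/2, and its mean is at least [r / 2].

The substance is thus the bound [KL (A, B) <= |A - B|_F^2 / alpha^2]
([kl_ising_le]), with the constant [C = 1 / alpha^2]. The divergence is at most
the symmetrised divergence, which is [E_A q - E_B q] for the energy
[q x = x^T (A - B) x / 2]; the derivative of [t |-> E_{B + t (A - B)} q] is the
variance of [q] ([is_derive_tilted_mean]), and the segment from [B] to [A]
stays in the region [|J|_inf <= 1 - alpha]. So it is enough to bound by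
[|A - B|_F^2 / alpha^2] the variance of a quadratic form under an Ising model
in that region ([energy_variance]).

That variance bound follows by using twice the Poincare inequality
[alpha Var f <= 1/4 sum_i E (f x - f (flip i x))^2] ([ising_poincare]).
Flipping the spin [i] changes [q] by [2 x_i ((A - B) x)_i], so the first use
bounds [alpha Var q] by [sum_i E ((A - B) x)_i^2]. Since [((A - B) x)_i] is
linear in [x] and has mean zero, the second use bounds each term by
[1 / alpha] times the squared norm of row [i].

The Poincare inequality holds for every positive probability weight on the
cube that satisfies Dobrushin's condition ([poincare]). Let [T] be the sum over
[i] of the operators that resample the spin [i] conditionally on the others.
Dobrushin's condition makes [T] contract the total oscillation by the factor
[n - alpha] ([sweep_oscillation]), so on mean-zero functions the norms of the
iterates of [T] grow at most like [(n - alpha)^m]. As [T] is self-adjoint, the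
squared norms of the iterates form a log-convex sequence, so that this
asymptotic rate already bounds the first step ([log_convex_ratio_le]). *)

(** * Heat-bath resampling on the cube *)

Definition flip n (i : 'I_n) (x : {ffun 'I_n -> bool}) : {ffun 'I_n -> bool} :=
  [ffun j => if j == i then ~~ x j else x j].

Lemma flipK n (i : 'I_n) : involutive (flip i).
Proof.
by move=> x; apply/ffunP => j; rewrite !ffunE; case: eqP => //; rewrite negbK.
Qed.

Lemma flipC n (i j : 'I_n) x : flip i (flip j x) = flip j (flip i x).
Proof. by apply/ffunP => k; rewrite !ffunE; case: eqP; case: eqP. Qed.

Lemma sum_flip (R : realType) n (i : 'I_n) (f : {ffun 'I_n -> bool} -> R) :
  \sum_x f x = \sum_x f (flip i x).
Proof. by rewrite (reindex_inj (inv_inj (flipK i))). Qed.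

(** One walks from [x] to [y] by changing one coordinate at a time. *)
Lemma oscillation_path (R : realType) n (f : {ffun 'I_n -> bool} -> R)
    (d : 'I_n -> R) :
  (forall i x, `|f x - f (flip i x)| <= d i) ->
  forall x y, `|f x - f y| <= \sum_i d i.
Proof.
move=> fd x y.
have d0 i : 0 <= d i by apply: le_trans (fd i x).
pose mix (s : seq 'I_n) : {ffun 'I_n -> bool} :=
  [ffun j => if j \in s then y j else x j].
have mixP s : `|f x - f (mix s)| <= \sum_(i <- s) d i.
  elim: s => [|i s IHs].
    have -> : mix [::] = x by apply/ffunP => j; rewrite ffunE in_nil.
    by rewrite big_nil subrr normr0.
  rewrite big_cons.
  have [->|->] : mix (i :: s) = mix s \/ mix (i :: s) = flip i (mix s).
  - have [e|ne] := eqVneq (mix s i) (y i).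
      left; apply/ffunP => j; move: e; rewrite !ffunE in_cons.
      by case: (eqVneq j i) => [->|_] //=.
    right; apply/ffunP => j; move: ne; rewrite !ffunE in_cons.
    by case: (eqVneq j i) => [->|_] //=; case: ifP; case: (x i); case: (y i).
  - by rewrite -[leLHS]add0r lerD.
  - rewrite (addrC (d i)); apply: le_trans (ler_distD (f (mix s)) _ _) _.
    exact: lerD.
have <- : mix (index_enum 'I_n) = y.
  by apply/ffunP => j; rewrite ffunE mem_index_enum.
exact: mixP.
Qed.

Section HeatBath.
Context (R : realType) (n : nat).
Implicit Types (w f g : {ffun 'I_n -> bool} -> R) (i j : 'I_n).

(** Resampling coordinate [i] from its conditional law given the others either
keeps [x], with this probability, or flips coordinate [i]. *)
Definition keep_prob w i x : R := w x / (w x + w (flip i x)).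

Definition resample w i f x : R :=
  keep_prob w i x * f x + (1 - keep_prob w i x) * f (flip i x).

Definition sweep w f x : R := \sum_i resample w i f x.

Definition dot w f g : R := \sum_x w x * (f x * g x).

Context (w : {ffun 'I_n -> bool} -> R) (w_gt0 : forall x, 0 < w x).

Lemma keep_prob01 i x : 0 <= keep_prob w i x <= 1.
Proof.
have s0 : 0 < w x + w (flip i x) by rewrite addr_gt0.
apply/andP; split; first by apply: divr_ge0; apply: ltW.
by rewrite ler_pdivrMr // mul1r lerDl ltW.
Qed.

Lemma detailed_balance i x :
  w x * (1 - keep_prob w i x) = w (flip i x) * keep_prob w i x.
Proof.
have s0 : w x + w (flip i x) != 0 by rewrite gt_eqF ?addr_gt0.
by rewrite /keep_prob; field.
Qed.

Lemma keep_prob_flip i x : keep_prob w i (flip i x) = 1 - keep_prob w i x.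
Proof.
have s0 : w x + w (flip i x) != 0 by rewrite gt_eqF ?addr_gt0.
rewrite /keep_prob flipK [w (flip i x) + _]addrC. by field.
Qed.

Lemma resample_flip i f x : resample w i f (flip i x) = resample w i f x.
Proof. by rewrite /resample keep_prob_flip flipK; ring. Qed.

(** Resampling is self-adjoint, by reversibility. *)
Lemma dot_resample i f g :
  dot w g (resample w i f) = dot w (resample w i g) f.
Proof.
rewrite /dot /resample.
under eq_bigr => x _.
  have -> : w x * (g x * (keep_prob w i x * f x
                           + (1 - keep_prob w i x) * f (flip i x))) =
     w x * keep_prob w i x * (f x * g x)
       + w x * (1 - keep_prob w i x) * (g x * f (flip i x)) by ring.
  over.
rewrite big_split /= [X in _ + X](sum_flip i) -big_split /=.
apply: eq_bigr => x _.
rewrite flipK detailed_balance flipK keep_prob_flip; ring.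
Qed.

(** The form on the left weighs [(f x - f (flip i x))^2] by half of the harmonic
ratio [w x * w x' / (w x + w x')], with [x' = flip i x], which is at most
[(w x + w x') / 4]. *)
Lemma dirichlet_form_le i f :
  dot w f f - dot w f (resample w i f) <=
    4^-1 * \sum_x w x * (f x - f (flip i x)) ^+ 2.
Proof.
(* The conductance of the edge between x and its flip. *)
pose k x := w x * (1 - keep_prob w i x).
have kflip x : k (flip i x) = k x.
  by rewrite /k detailed_balance flipK keep_prob_flip.
have kle x : k x <= (w x + w (flip i x)) / 4.
  have s0 : 0 < w x + w (flip i x) by rewrite addr_gt0.
  have -> : k x = w x * w (flip i x) / (w x + w (flip i x)).
    by rewrite /k /keep_prob; field; rewrite gt_eqF.
  rewrite ler_pdivrMr //; have := sqr_ge0 (w x - w (flip i x)); nra.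
have -> : dot w f f - dot w f (resample w i f) =
    \sum_x k x * (f x * (f x - f (flip i x))).
  rewrite -sumrB; apply: eq_bigr => x _.
  by rewrite /k /resample; ring.
have -> : \sum_x k x * (f x * (f x - f (flip i x))) =
    2^-1 * \sum_x k x * (f x - f (flip i x)) ^+ 2.
  rewrite [LHS](_ : _ = 2^-1 * (\sum_x k x * (f x * (f x - f (flip i x))) +
     \sum_x k x * (f x * (f x - f (flip i x))))); last by field.
  rewrite [X in _ + X](sum_flip i) -big_split; congr (_ * _).
  by apply: eq_bigr => x _; rewrite kflip flipK /=; ring.
have -> : 4^-1 * \sum_x w x * (f x - f (flip i x)) ^+ 2 =
    2^-1 * \sum_x (w x + w (flip i x)) / 4 * (f x - f (flip i x)) ^+ 2.
  rewrite [in LHS](_ : 4^-1 = 2^-1 * (4^-1 + 4^-1)); last by field.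
  rewrite -mulrA; congr (_ * _); rewrite mulrDl.
  rewrite [X in _ + _ * X](sum_flip i) !mulr_sumr -big_split.
  by apply: eq_bigr => x _; rewrite flipK /=; field.
rewrite ler_pM2l ?invr_gt0 //; apply: ler_sum => x _.
by rewrite ler_wpM2r // sqr_ge0.
Qed.

(** The sum over coordinates of the largest effect of a flip, expressed through
upper bounds [d i] so as to avoid maxima. *)
Definition oscillation_le f (K : R) : Prop :=
  exists2 d : 'I_n -> R,
    (forall i x, `|f x - f (flip i x)| <= d i) & \sum_i d i <= K.

Context (C : 'I_n -> 'I_n -> R) (a : R).
Hypothesis C_ge0 : forall i j, 0 <= C i j.
Hypothesis influence : forall i j x, i != j ->
  `|keep_prob w i x - keep_prob w i (flip j x)| <= C i j.
Hypothesis dobrushin : forall i, \sum_j C i j <= 1 - a.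

(** Flipping [j] changes the resampled value of [f] at [i] in two ways: through
[f] itself, by at most [d j], and through the conditional law at [i], which
moves by at most [C i j] and weighs a difference of at most [d i]. *)
Lemma resample_oscillation f (d : 'I_n -> R) i j x :
  (forall k y, `|f y - f (flip k y)| <= d k) -> i != j ->
  `|resample w i f x - resample w i f (flip j x)| <= d j + C i j * d i.
Proof.
move=> fd ij.
have /andP[] := keep_prob01 i x; have := influence x ij; rewrite /resample.
move: (keep_prob w i x) (keep_prob w i (flip j x)) => p q pq p0 p1.
rewrite (flipC i j).
have -> : p * f x + (1 - p) * f (flip i x)
    - (q * f (flip j x) + (1 - q) * f (flip j (flip i x))) =
    p * (f x - f (flip j x))
    + (1 - p) * (f (flip i x) - f (flip j (flip i x)))
    + (p - q) * (f (flip j x) - f (flip i (flip j x))).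
  by rewrite (flipC i j); ring.
apply: le_trans (ler_normD _ _) _; rewrite lerD //.
  apply: le_trans (ler_normD _ _) _; rewrite !normrM (ger0_norm p0).
  rewrite (@ger0_norm _ (1 - p)) ?subr_ge0 //.
  have h1 := fd j x; have h2 := fd j (flip i x); nra.
by rewrite normrM ler_pM.
Qed.

(** Resampling [i] erases the oscillation [d i] and spreads at most
[(1 - a) * d i] of it over the other coordinates: summed over [i], each [d i]
is counted [n - 1] times unchanged, plus [1 - a] times. *)
Lemma sweep_oscillation f K :
  oscillation_le f K -> 0 <= n%:R - a ->
  oscillation_le (sweep w f) ((n%:R - a) * K).
Proof.
move=> [d fd dK] na.
have d0 i (x : {ffun 'I_n -> bool}) : 0 <= d i by apply: le_trans (fd i x).
have d0' i : 0 <= d i := d0 i [ffun => false].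
exists (fun j => (n%:R - 1) * d j + \sum_i C i j * d i).
  move=> j x; rewrite /sweep -sumrB; apply: le_trans (ler_norm_sum _ _ _) _.
  rewrite (bigD1 j) //= resample_flip subrr normr0 add0r.
  apply: (@le_trans _ _ (\sum_(i | i != j) (d j + C i j * d i))).
    by apply: ler_sum => i ij; exact: resample_oscillation.
  have : \sum_i (d j + C i j * d i) = n%:R * d j + \sum_i C i j * d i.
    by rewrite big_split /= sumr_const card_ord -[d j *+ n]mulr_natl.
  rewrite (bigD1 j) //=; have := mulr_ge0 (C_ge0 j j) (d0' j); lra.
rewrite big_split /= -mulr_sumr exchange_big /=.
apply: (@le_trans _ _ ((n%:R - 1) * \sum_i d i + (1 - a) * \sum_i d i)).
  rewrite lerD2l mulr_sumr; apply: ler_sum => i _.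
  by rewrite -mulr_suml ler_wpM2r.
by rewrite -mulrDl addrA subrK ler_wpM2l.
Qed.
End HeatBath.

(** * The Poincare inequality under Dobrushin's condition *)

Lemma bernoulli (R : realFieldType) (e : R) m : 0 <= e ->
  1 + m%:R * e <= (1 + e) ^+ m.
Proof.
move=> e0; elim: m => [|m IHm]; first by rewrite mul0r addr0 expr0.
rewrite exprS -natr1.
have := mulr_ge0 (ler0n R m) (mulr_ge0 e0 e0); nra.
Qed.

(** The second hypothesis is log-convexity, [b m.+1 ^+ 2 <= b m * b m.+2], in its
linearised form. The ratios of successive terms are then nondecreasing, so if
the first one exceeded [mu], then [b] would grow faster than [mu ^+ m]. *)
Lemma log_convex_ratio_le (R : archiRealFieldType) (b : nat -> R) (K mu : R) :
  (forall m, 0 <= b m) ->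
  (forall rho m, 2 * rho * b m.+1 <= rho ^+ 2 * b m + b m.+2) ->
  0 <= mu -> (forall m, b m <= K * mu ^+ m) -> b 1 <= mu * b 0.
Proof.
move=> b0 blc mu0 bK; rewrite leNgt; apply/negP => blt.
have b1 : 0 < b 1 by apply: le_lt_trans blt; rewrite mulr_ge0.
have mu_gt0 : 0 < mu.
  rewrite lt_neqAle mu0 andbT eq_sym; apply/eqP => m0.
  by have := bK 1; rewrite m0 expr1 mulr0 leNgt b1.
(* Any rho > mu with rho * b 0 <= b 1 does; the 1 in the denominator covers
   the case b 0 = 0. *)
pose e := (b 1 - mu * b 0) / (b 0 + 1).
have b01 : 0 < b 0 + 1 by have := b0 0; lra.
have e0 : 0 < e by rewrite divr_gt0 // subr_gt0.
pose rho := mu + e.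
have rho0 : 0 < rho by rewrite addr_gt0.
have rhob0 : rho * b 0 <= b 1.
  have : e * (b 0 + 1) = b 1 - mu * b 0 by rewrite /e divfK // gt_eqF.
  by rewrite /rho; move: e0; nra.
have growth m : rho * b m <= b m.+1.
  elim: m => // m IHm; have := blc rho m; nra.
have geom m : b 1 * rho ^+ m <= b m.+1.
  elim: m => [|m IHm]; first by rewrite expr0 mulr1.
  by apply: le_trans (growth m.+1); rewrite exprS mulrCA ler_pM2l.
(* Dividing by mu ^+ m, Bernoulli gives a linear lower bound against a
   constant, which the Archimedean property excludes. *)
have bound m : b 1 * (1 + m%:R * (e / mu)) <= K * mu.
  have mum : 0 < mu ^+ m by rewrite exprn_gt0.
  rewrite -(ler_pM2r mum) -[leRHS]mulrA -exprS.
  apply: le_trans (bK m.+1); apply: le_trans (geom m).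
  have -> : rho ^+ m = (1 + e / mu) ^+ m * mu ^+ m.
    by rewrite -exprMn mulrDl mul1r divfK // gt_eqF.
  rewrite [leRHS]mulrA ler_pM2r // ler_pM2l //.
  by apply: bernoulli; rewrite divr_ge0 ?ltW.
have c0 : 0 < b 1 * (e / mu) by rewrite mulr_gt0 // divr_gt0.
have KM : 0 <= K * mu / (b 1 * (e / mu)).
  apply: divr_ge0; last exact: ltW.
  by apply: le_trans (bound 0); rewrite mul0r addr0 mulr1 ltW.
have := archi_boundP KM; rewrite ltr_pdivrMr // ltNge => /negP; apply.
apply: le_trans (bound (Num.bound (K * mu / (b 1 * (e / mu))))).
by rewrite mulrDr mulr1 mulrCA lerDr ltW.
Qed.

Section Poincare.
Context (R : realType) (n : nat).
Implicit Types (w f g : {ffun 'I_n -> bool} -> R) (i j : 'I_n).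
Context (w : {ffun 'I_n -> bool} -> R) (w_gt0 : forall x, 0 < w x)
  (w_sum1 : \sum_x w x = 1).

Lemma dot_sweepr f g : dot w f (sweep w g) = \sum_i dot w f (resample w i g).
Proof.
rewrite /dot exchange_big; apply: eq_bigr => x _.
by rewrite /sweep !mulr_sumr.
Qed.

Lemma dot_sweepl f g : dot w (sweep w f) g = \sum_i dot w (resample w i f) g.
Proof.
rewrite /dot exchange_big; apply: eq_bigr => x _.
by rewrite /sweep mulr_suml mulr_sumr.
Qed.

Lemma dot_sweep f g : dot w f (sweep w g) = dot w (sweep w f) g.
Proof.
by rewrite dot_sweepr dot_sweepl; apply: eq_bigr => i _; exact: dot_resample.
Qed.

Lemma mean_sweep f : \sum_x w x * sweep w f x = n%:R * \sum_x w x * f x.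
Proof.
have := dot_sweep (fun=> 1) f; rewrite /dot.
under eq_bigr do rewrite mul1r.
move=> ->; rewrite mulr_sumr; apply: eq_bigr => x _.
have -> : sweep w (fun=> 1) x = n%:R.
  rewrite /sweep (eq_bigr (fun=> 1)) ?sumr_const ?card_ord // => i _.
  by rewrite /resample !mulr1 addrC subrK.
by rewrite mulrCA.
Qed.

(** A mean-zero function differs from its mean by at most its oscillation. *)
Lemma mean0_bound f K x : \sum_x w x * f x = 0 -> oscillation_le f K ->
  `|f x| <= K.
Proof.
move=> fmean [d fd dK]; apply: le_trans dK.
have -> : f x = \sum_y w y * (f x - f y).
  under eq_bigr do rewrite mulrBr.
  by rewrite sumrB fmean subr0 -mulr_suml w_sum1 mul1r.
apply: le_trans (ler_norm_sum _ _ _) _.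
rewrite -[leRHS]mul1r -w_sum1 mulr_suml; apply: ler_sum => y _.
rewrite normrM gtr0_norm // ler_pM2l //; exact: oscillation_path.
Qed.

Lemma dot_amgm f g (c : R) :
  2 * c * dot w f g <= c ^+ 2 * dot w f f + dot w g g.
Proof.
rewrite /dot !mulr_sumr -big_split /=; apply: ler_sum => x _.
have := mulr_ge0 (ltW (w_gt0 x)) (sqr_ge0 (c * f x - g x)); nra.
Qed.

Context (C : 'I_n -> 'I_n -> R) (a : R) (a_lt1 : a < 1).
Hypothesis C_ge0 : forall i j, 0 <= C i j.
Hypothesis influence : forall i j x, i != j ->
  `|keep_prob w i x - keep_prob w i (flip j x)| <= C i j.
Hypothesis dobrushin : forall i, \sum_j C i j <= 1 - a.

(** On mean-zero functions the spectral bound for [sweep w] is read off from the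
growth of [dot w (F m) (F m)], where [F m] is the [m]-th iterate. A growth
rate does not see constant factors, so a crude bound [K] on the oscillation of
[f] is good enough. *)
Lemma sweep_contraction f : (0 < n)%N -> \sum_x w x * f x = 0 ->
  dot w f (sweep w f) <= (n%:R - a) * dot w f f.
Proof.
move=> n0 fmean.
have na : 0 < n%:R - a.
  by rewrite subr_gt0; apply: lt_le_trans a_lt1 _; rewrite ler1n.
pose F m := iter m (sweep w) f.
pose K := \sum_i \sum_x `|f x - f (flip i x)|.
have Fosc m : oscillation_le (F m) ((n%:R - a) ^+ m * K).
  elim: m => [|m IHm]; last first.
    by rewrite exprS -mulrA; apply: sweep_oscillation dobrushin _ _ _ _ => //;
       exact: ltW.
  exists (fun i => \sum_x `|f x - f (flip i x)|); last by rewrite mul1r.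
  by move=> i x; rewrite (bigD1 x) //= lerDl sumr_ge0.
have Fmean m : \sum_x w x * F m x = 0.
  by elim: m => //= m IHm; rewrite mean_sweep IHm mulr0.
have b1 : dot w (F 1) (F 1) <= (n%:R - a) ^+ 2 * dot w (F 0) (F 0).
  apply: (@log_convex_ratio_le _ (fun m => dot w (F m) (F m)) (K ^+ 2)).
  - by move=> m; apply: sumr_ge0 => x _; rewrite -expr2 mulr_ge0 ?sqr_ge0 1?ltW.
  - move=> rho m; have := dot_amgm (F m) (F m.+2) rho.
    by rewrite -[F m.+2]/(sweep w (F m.+1)) dot_sweep.
  - exact: sqr_ge0.
  - move=> m; rewrite -[leRHS]mul1r -[X in _ <= X * _]w_sum1 mulr_suml.
    apply: ler_sum => x _; rewrite ler_pM2l // -exprM mulnC exprM -exprMn -expr2 [K * _]mulrC.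
    have := mean0_bound x (Fmean m) (Fosc m).
    rewrite -(real_normK (num_real (F m x))).
    by move=> h; rewrite expr2 [leRHS]expr2 ler_pM.
have := dot_amgm (F 0) (F 1) (n%:R - a).
rewrite -[F 1]/(sweep w f) -[F 0]/f in b1 * => h.
rewrite -(@ler_pM2l _ (2 * (n%:R - a))) ?mulr_gt0 //; nra.
Qed.

(** The difference of [n * dot w f f] and [dot w f (sweep w f)] is the sum of the
Dirichlet forms of the coordinates, and is at least [a * dot w f f]. *)
Theorem poincare f : \sum_x w x * f x = 0 ->
  a * \sum_x w x * f x ^+ 2 <=
    4^-1 * \sum_i \sum_x w x * (f x - f (flip i x)) ^+ 2.
Proof.
move=> fmean.
have -> : \sum_x w x * f x ^+ 2 = dot w f f.
  by apply: eq_bigr => x _; rewrite expr2.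
(* For n = 0 the factor n - a may be negative, but the cube is one point. *)
have [n0|n_gt0] := posnP n.
  have -> : dot w f f = 0.
    apply: big1 => x _.
    have -> : f x = 0; last by rewrite !mul0r mulr0.
    apply/eqP; rewrite -normr_le0; apply: mean0_bound => //.
    exists (fun=> 0); last by rewrite big1.
    by move=> i; have := ltn_ord i; rewrite [X in (_ < X)%N]n0.
  rewrite mulr0 mulr_ge0 ?invr_ge0 //.
  by do 2! (apply: sumr_ge0 => ? _); rewrite mulr_ge0 ?sqr_ge0 1?ltW.
have h := sweep_contraction n_gt0 fmean.
have : n%:R * dot w f f - dot w f (sweep w f) <=
    4^-1 * \sum_i \sum_x w x * (f x - f (flip i x)) ^+ 2.
  rewrite dot_sweepr mulr_natl -[n in _ *+ n]card_ord -sumr_const -sumrB.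
  by rewrite mulr_sumr; apply: ler_sum => i _; exact: dirichlet_form_le.
by apply: le_trans; rewrite lerBrDr; apply: le_trans (lerD (lexx _) h) _; lra.
Qed.
End Poincare.

(** * Calculus: the logistic function and exponential tilting *)

Definition logistic (R : realType) (u : R) : R := (1 + expR (- u))^-1.

Lemma is_derive_logistic (R : realType) (u : R) :
  is_derive u 1 (@logistic R) (expR (- u) / (1 + expR (- u)) ^+ 2).
Proof.
have p0 : 0 < 1 + expR (- u) by rewrite addr_gt0 ?expR_gt0.
have d1 : is_derive u (1 : R) (fun v : R => 1 + expR (- v)) (- expR (- u)).
  have h := @is_derive1_comp R expR (@GRing.opp R) u _ _
    (is_derive_expR _) (is_deriveN (is_derive_id u 1)).
  have := is_deriveD (is_derive_cst (1 : R) u (1 : R)) h.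
  by rewrite add0r mulrN mulr1.
have := @is_deriveV R (fun v : R => 1 + expR (- v)) u _ 1 (lt0r_neq0 p0) d1.
rewrite /logistic => h; apply: is_derive_eq h _.
by rewrite scaleNr scalerN opprK /GRing.scale /= mulrC.
Qed.

(** The constant 1/4 is the largest value of the derivative. It is what turns
the influence of spin [j] on spin [i] into exactly [`|J i j|]. *)
Lemma logistic_lipschitz (R : realType) (u v : R) :
  `|logistic u - logistic v| <= `|u - v| / 4.
Proof.
wlog vu : u v / v <= u.
  move=> wlg; have [/wlg//|/ltW/wlg] := leP v u.
  by rewrite distrC [X in _ <= X / _]distrC.
have [c _ ->] := MVT_segment vu (fun x _ => is_derive_logistic x)
  (derivable_within_continuous (fun x _ =>
     @ex_derive _ _ _ _ _ _ _ (is_derive_logistic x))).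
rewrite normrM mulrC ler_wpM2l //.
have e0 := expR_gt0 (- c).
have s0 : 0 < (1 + expR (- c)) ^+ 2 by rewrite exprn_gt0 // addr_gt0.
rewrite ger0_norm; last by rewrite divr_ge0 ?ltW.
rewrite ler_pdivrMr //; have := sqr_ge0 (1 - expR (- c)); nra.
Qed.

Lemma is_derive_bigsum (R : realType) (I : Type) (s : seq I) (f : I -> R -> R)
    (df : I -> R) (t : R) :
  (forall i, is_derive t 1 (f i) (df i)) ->
  is_derive t 1 (fun u => \sum_(i <- s) f i u) (\sum_(i <- s) df i).
Proof.
move=> fd; elim: s => [|i s IHs].
  have -> : (fun u => \sum_(i <- [::]) f i u) = cst 0.
    by apply/funext => u; rewrite big_nil.
  by rewrite big_nil; exact: is_derive_cst.
have -> : (fun u => \sum_(j <- i :: s) f j u) =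
    f i \+ (fun u => \sum_(j <- s) f j u).
  by apply/funext => u; rewrite big_cons.
by rewrite big_cons; exact: is_deriveD.
Qed.

(** An exponential family on a finite set: in the parameter [t], the mean of [b]
has its variance as derivative. *)
Section ExponentialFamily.
Context (R : realType) (I : finType) (x0 : I) (a b : I -> R).

Definition tilt (t : R) (x : I) : R := expR (a x + t * b x).

Definition tilted_mean (t : R) (f : I -> R) : R :=
  (\sum_x tilt t x * f x) / \sum_x tilt t x.

Lemma tilt_sum_gt0 t : 0 < \sum_x tilt t x.
Proof.
rewrite (bigD1 x0) //= ltr_pwDl ?expR_gt0 // sumr_ge0 // => x _.
exact: expR_ge0.
Qed.

Lemma is_derive_tilt_sum (t : R) (f : I -> R) :
  is_derive t (1 : R) (fun u : R => \sum_x tilt u x * f x)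
    (\sum_x tilt t x * (b x * f x)).
Proof.
apply: is_derive_bigsum => x.
have d1 : is_derive t (1 : R) (fun u : R => a x + u * b x) (b x).
  have h := @is_deriveM R R (@id R) (cst (b x)) t 1 _ _ (is_derive_id t 1)
     (is_derive_cst (b x) t 1).
  apply: (is_derive_eq (is_deriveD (is_derive_cst (a x) t (1 : R)) h)).
  by rewrite scaler0 !add0r /GRing.scale /= mulr1.
have h := @is_derive1_comp R expR _ t _ _ (is_derive_expR _) d1.
apply: (is_derive_eq (@is_deriveM R R _ (cst (f x)) t 1 _ _ h
  (is_derive_cst (f x) t 1))).
by rewrite scaler0 add0r /GRing.scale /= /tilt; ring.
Qed.

Lemma is_derive_tilted_mean (t : R) :
  is_derive t (1 : R) (fun u : R => tilted_mean u b)
    (tilted_mean t (fun x => (b x - tilted_mean t b) ^+ 2)).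
Proof.
have Z0 := tilt_sum_gt0 t.
have dN := is_derive_tilt_sum t b.
have dZ : is_derive t (1 : R) (fun u : R => \sum_x tilt u x)
    (\sum_x tilt t x * b x).
  have := is_derive_tilt_sum t (fun=> 1).
  under eq_fun do under eq_bigr do rewrite mulr1.
  by under eq_bigr do rewrite mulr1.
have dV := @is_deriveV R _ t _ 1 (lt0r_neq0 Z0) dZ.
apply: (is_derive_eq (is_deriveM dN dV)).
rewrite /GRing.scale /= [in RHS]/tilted_mean.
under [in RHS]eq_bigr => x _.
  have -> : tilt t x * (b x - tilted_mean t b) ^+ 2 =
    tilt t x * (b x * b x) - 2 * tilted_mean t b * (tilt t x * b x)
     + tilted_mean t b ^+ 2 * tilt t x by ring.
  over.
rewrite big_split sumrB /= -!mulr_sumr /tilted_mean.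
by field; rewrite gt_eqF.
Qed.

Lemma tilted_mean_increment V :
  (forall t, 0 <= t <= 1 ->
     tilted_mean t (fun x => (b x - tilted_mean t b) ^+ 2) <= V) ->
  tilted_mean 1 b - tilted_mean 0 b <= V.
Proof.
move=> hV; have [c c01 ->] := MVT_segment ler01
  (fun x _ => is_derive_tilted_mean x)
  (derivable_within_continuous (fun x _ =>
     @ex_derive _ _ _ _ _ _ _ (is_derive_tilted_mean x))).
by rewrite subr0 mulr1; apply: hV.
Qed.
End ExponentialFamily.

(** * The Ising model at high temperature *)

Section Ising.
Context (R : realType) (n : nat).
Implicit Types (J A B : 'M[R]_n) (x : {ffun 'I_n -> bool}) (i j : 'I_n).

Definition energy J x : R := ((spins R x)^T *m J *m spins R x) 0 0 / 2.

Definition local_field J i x : R := \sum_j J i j * (-1) ^+ x j.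

Lemma energyD J A x (t : R) :
  energy (J + t *: A) x = energy J x + t * energy A x.
Proof.
by rewrite /energy mulmxDr mulmxDl -scalemxAr -scalemxAl !mxE; field.
Qed.

Lemma energyE J x : energy J x = (\sum_i (-1) ^+ x i * local_field J i x) / 2.
Proof.
congr (_ / 2); rewrite -mulmxA mxE; apply: eq_bigr => i _.
rewrite !mxE; congr (_ * _).
by apply: eq_bigr => j _; rewrite !mxE.
Qed.

Lemma sign_flip i x j :
  (-1) ^+ flip i x j = (-1) ^+ x j - (j == i)%:R * 2 * (-1) ^+ x i :> R.
Proof.
rewrite ffunE; case: eqVneq => [->|_]; last by rewrite !mul0r subr0.
by rewrite /= signrN; ring.
Qed.

Lemma local_field_flip J i j x :
  local_field J i (flip j x) = local_field J i x - 2 * J i j * (-1) ^+ x j.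
Proof.
rewrite /local_field; under eq_bigr do rewrite sign_flip mulrBr.
rewrite sumrB; congr (_ - _).
rewrite (bigD1 j) //= eqxx big1 ?addr0 /=; first by ring.
by move=> k /negPf ->; rewrite !mul0r mulr0.
Qed.

(** The flip subtracts [2 x_i e_i] from the spin vector; the term of second order
is a multiple of [J i i], which vanishes. *)
Lemma energy_flip J i x : interaction_matrix J ->
  energy J x - energy J (flip i x) = 2 * (-1) ^+ x i * local_field J i x.
Proof.
move=> [Jsym Jdiag]; rewrite !energyE.
have JsymE k l : J k l = J l k by rewrite -{1}Jsym mxE.
have -> : \sum_k (-1) ^+ flip i x k * local_field J k (flip i x) =
  \sum_k (-1) ^+ x k * local_field J k x
  - 4 * (-1) ^+ x i * local_field J i x.
  under eq_bigr => k _.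
    have -> : (-1) ^+ flip i x k * local_field J k (flip i x) =
      (-1) ^+ x k * local_field J k x
      - 2 * (-1) ^+ x i * (J i k * (-1) ^+ x k)
      - (k == i)%:R * (2 * (-1) ^+ x i * local_field J i x).
      rewrite local_field_flip sign_flip (JsymE i k).
      case: (eqVneq k i) => [->|_]; rewrite ?Jdiag /=.
        by move: (local_field J i x) ((-1) ^+ x i) => m s; ring.
      move: (local_field J k x) ((-1) ^+ x k) ((-1) ^+ x i) => m s t.
      by ring.
    over.
  rewrite !sumrB -mulr_sumr -/(local_field J i x).
  have delta (c : R) : \sum_k (k == i)%:R * c = c.
    rewrite (bigD1 i) //= eqxx mul1r big1 ?addr0 // => k /negPf ->.
    by rewrite mul0r.
  by rewrite delta; move: (local_field J i x) ((-1) ^+ x i) => m s; ring.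
by move: ((-1) ^+ x i) => s; field.
Qed.

Lemma ising_weight_gt0 J x : 0 < ising_weight J x.
Proof. exact: expR_gt0. Qed.

Lemma partition_gt0 J : 0 < \sum_x ising_weight J x.
Proof.
rewrite (bigD1 [ffun => false]) //= ltr_pwDl ?ising_weight_gt0 //.
by rewrite sumr_ge0 // => x _; rewrite ltW ?ising_weight_gt0.
Qed.

Lemma ising_prob_gt0 J x : 0 < ising_prob J x.
Proof. by rewrite divr_gt0 ?ising_weight_gt0 ?partition_gt0. Qed.

Lemma ising_prob_sum1 J : \sum_x ising_prob J x = 1.
Proof. by rewrite -mulr_suml mulfV // gt_eqF // partition_gt0. Qed.

Lemma ising_keep_prob J i x : interaction_matrix J ->
  keep_prob (ising_prob J) i x =
    logistic (2 * (-1) ^+ x i * local_field J i x).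
Proof.
move=> HJ; rewrite -energy_flip // /logistic opprB expRD expRN.
have Z := partition_gt0 J.
have w1 := ising_weight_gt0 J x; have w2 := ising_weight_gt0 J (flip i x).
rewrite -[expR (energy J x)]/(ising_weight J x).
rewrite -[expR (energy J _)]/(ising_weight J (flip i x)).
rewrite /keep_prob /ising_prob; field.
by rewrite !gt_eqF ?addr_gt0.
Qed.

(** The conditional law of spin [i] is the logistic function of twice its local
field, up to sign, and flipping [j] changes that argument by [4 * `|J i j|]. *)
Lemma ising_influence J i j x : interaction_matrix J -> i != j ->
  `|keep_prob (ising_prob J) i x - keep_prob (ising_prob J) i (flip j x)|
    <= `|J i j|.
Proof.
move=> HJ ij; rewrite !ising_keep_prob //.
apply: le_trans (logistic_lipschitz _ _) _.
rewrite local_field_flip sign_flip (negPf ij) !mul0r subr0 -mulrBr.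
rewrite opprB addrC subrK !normrM !normrX !normrN1 !expr1n !mulr1 ger0_norm //.
by rewrite ler_pdivrMr // mulrA -natrM mulrC.
Qed.

Lemma row_sum_le_norm_inf J i : \sum_j `|J i j| <= norm_inf J.
Proof. exact: (le_bigmax_cond). Qed.

Context (alpha : R) (alpha_gt0 : 0 < alpha) (alpha_lt1 : alpha < 1).

Lemma ising_poincare J f : interaction_matrix J -> norm_inf J <= 1 - alpha ->
  \sum_x ising_prob J x * f x = 0 ->
  alpha * \sum_x ising_prob J x * f x ^+ 2 <=
    4^-1 * \sum_i \sum_x ising_prob J x * (f x - f (flip i x)) ^+ 2.
Proof.
move=> HJ Jinf; apply: (@poincare _ _ _ _ _ (fun i j => `|J i j|)) => //.
- exact: ising_prob_gt0.
- exact: ising_prob_sum1.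
- by move=> i j x ij; exact: ising_influence.
- by move=> i; apply: le_trans Jinf; exact: row_sum_le_norm_inf.
Qed.

(** In the absence of an external field the model is invariant under a global
spin flip, so that odd functions have mean zero. *)
Definition flip_all x : {ffun 'I_n -> bool} := [ffun i => ~~ x i].

Lemma flip_allK : involutive flip_all.
Proof. by move=> x; apply/ffunP => i; rewrite !ffunE negbK. Qed.

Lemma local_field_flip_all J i x :
  local_field J i (flip_all x) = - local_field J i x.
Proof.
rewrite /local_field -sumrN; apply: eq_bigr => j _.
by rewrite ffunE signrN mulrN.
Qed.

Lemma ising_prob_flip_all J x : ising_prob J (flip_all x) = ising_prob J x.
Proof.
rewrite /ising_prob; congr (expR _ / _).
rewrite -/(energy J _) -/(energy J x) !energyE; congr (_ / 2).
by apply: eq_bigr => i _; rewrite local_field_flip_all ffunE signrN mulrNN.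
Qed.

Lemma local_field_mean0 J A i :
  \sum_x ising_prob J x * local_field A i x = 0.
Proof.
set S := LHS; have : S = - S; last by lra.
rewrite {1}/S (reindex_inj (inv_inj flip_allK)) -sumrN /=.
by apply: eq_bigr => x _; rewrite ising_prob_flip_all local_field_flip_all mulrN.
Qed.

(** A flip of [j] changes the linear form [local_field A i] by exactly
[2 * `|A i j|]. *)
Lemma local_field_second_moment J A i :
  interaction_matrix J -> norm_inf J <= 1 - alpha ->
  alpha * \sum_x ising_prob J x * local_field A i x ^+ 2 <=
    \sum_j A i j ^+ 2.
Proof.
move=> HJ Jinf.
apply: le_trans (ising_poincare HJ Jinf (local_field_mean0 J A i)) _.
rewrite mulr_sumr; apply: ler_sum => j _.
under eq_bigr => x _.
  have -> : (local_field A i x - local_field A i (flip j x)) ^+ 2 =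
      4 * A i j ^+ 2.
    have -> : local_field A i x - local_field A i (flip j x) =
      2 * A i j * (-1) ^+ x j by rewrite local_field_flip; ring.
    by rewrite exprMn sqrr_sign mulr1 exprMn -natrX.
  over.
by rewrite -mulr_suml ising_prob_sum1 mul1r mulrA mulVf // mul1r.
Qed.

Lemma norm_F_sqr A : norm_F A ^+ 2 = \sum_i \sum_j A i j ^+ 2.
Proof.
by rewrite sqr_sqrtr //; do 2! (apply: sumr_ge0 => ? _); rewrite sqr_ge0.
Qed.

(** The Poincare inequality is used for the energy, then for the local fields. *)
Lemma energy_variance J A : interaction_matrix J -> norm_inf J <= 1 - alpha ->
  interaction_matrix A ->
  alpha ^+ 2 * \sum_x ising_prob J x *
      (energy A x - \sum_y ising_prob J y * energy A y) ^+ 2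
    <= norm_F A ^+ 2.
Proof.
move=> HJ Jinf HA; set m := \sum_y _ * energy A y.
have mean0 : \sum_x ising_prob J x * (energy A x - m) = 0.
  under eq_bigr do rewrite mulrBr.
  by rewrite sumrB -mulr_suml ising_prob_sum1 mul1r subrr.
rewrite expr2 -mulrA.
apply: (@le_trans _ _ (alpha * \sum_i \sum_x ising_prob J x *
    local_field A i x ^+ 2)); last first.
  rewrite mulr_sumr norm_F_sqr; apply: ler_sum => i _.
  exact: local_field_second_moment.
rewrite ler_pM2l //; apply: le_trans (ising_poincare HJ Jinf mean0) _.
rewrite mulr_sumr; apply: ler_sum => i _.
rewrite mulr_sumr; apply: ler_sum => x _.
have -> : energy A x - m - (energy A (flip i x) - m) =
    2 * (-1) ^+ x i * local_field A i x by rewrite -energy_flip //; ring.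
by rewrite !exprMn sqrr_sign; lra.
Qed.

Lemma interaction_matrixD A B (t : R) :
  interaction_matrix A -> interaction_matrix B ->
  interaction_matrix (A + t *: B).
Proof.
move=> [As Ad] [Bs Bd]; split; first by rewrite linearD linearZ /= As Bs.
by move=> i; rewrite !mxE Ad Bd mulr0 addr0.
Qed.

Lemma norm_inf_segment A B (t c : R) : 0 <= t <= 1 -> 0 <= c ->
  norm_inf A <= c -> norm_inf B <= c -> norm_inf (B + t *: (A - B)) <= c.
Proof.
move=> /andP[t0 t1] c0 Ac Bc; apply: bigmax_le => // i _.
apply: (@le_trans _ _ (t * \sum_j `|A i j| + (1 - t) * \sum_j `|B i j|)).
  rewrite !mulr_sumr -big_split; apply: ler_sum => j _ /=.
  rewrite !mxE (_ : _ + _ = t * A i j + (1 - t) * B i j); last by ring.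
  apply: le_trans (ler_normD _ _) _.
  by rewrite !normrM (ger0_norm t0) (@ger0_norm _ (1 - t)) ?subr_ge0.
have := le_trans (row_sum_le_norm_inf A i) Ac.
have := le_trans (row_sum_le_norm_inf B i) Bc; nra.
Qed.

(** Mean value theorem along the segment from [B] to [A], with the variance as
derivative. *)
Lemma energy_increment A B :
  interaction_matrix A -> interaction_matrix B ->
  norm_inf A <= 1 - alpha -> norm_inf B <= 1 - alpha ->
  ising_expectation A (energy (A - B)) - ising_expectation B (energy (A - B))
    <= norm_F (A - B) ^+ 2 / alpha ^+ 2.
Proof.
move=> HA HB Ainf Binf.
have HAB : interaction_matrix (A - B).
  by have := interaction_matrixD (-1) HA HB; rewrite scaleN1r.
have tiltE t f : tilted_mean (energy B) (energy (A - B)) t f =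
    ising_expectation (B + t *: (A - B)) f.
  rewrite /tilted_mean mulr_suml /ising_expectation; apply: eq_bigr => x _.
  rewrite mulrAC /ising_prob; congr (_ / _ * _).
    by rewrite /tilt -energyD.
  by apply: eq_bigr => y _; rewrite /tilt -energyD.
have := @tilted_mean_increment R _ [ffun => false] (energy B) (energy (A - B))
  (norm_F (A - B) ^+ 2 / alpha ^+ 2).
rewrite !tiltE scale1r scale0r addr0 [B + (A - B)]addrC subrK; apply => t t01.
rewrite !tiltE ler_pdivlMr ?exprn_gt0 // mulrC.
apply: energy_variance => //; first exact: interaction_matrixD.
by apply: norm_inf_segment => //; rewrite subr_ge0 ltW.
Qed.
End Ising.

(** * Fano's inequality and separated families *)

Section Fano.
Context (R : realType) (T : finType).
Implicit Types (P Q : T -> R).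

Definition kl P Q : R := \sum_x P x * ln (P x / Q x).

(** The Donsker-Varadhan bound with the logarithm of [E_Q (exp g)] replaced by
its tangent at [c]. Pointwise it is [1 + t <= exp t] for
[t = g x - ln (P x / Q x) - ln c]. The linearised form can be averaged over
several [P] without Jensen's inequality. *)
Lemma donsker_varadhan P Q (g : T -> R) (c : R) :
  (forall x, 0 < P x) -> (forall x, 0 < Q x) -> \sum_x P x = 1 -> 0 < c ->
  \sum_x P x * g x <= kl P Q + ln c + (\sum_x Q x * expR (g x)) / c - 1.
Proof.
move=> P0 Q0 P1 c0; rewrite -[X in _ - X]P1 -[ln c]mul1r -P1.
rewrite /kl !mulr_suml -!big_split -sumrB; apply: ler_sum => x _ /=.
have := expR_ge1Dx (g x - ln (P x / Q x) - ln c).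
have PQ : P x / Q x \is Num.pos by rewrite posrE divr_gt0.
rewrite !expRD !expRN !lnK ?posrE // => /(ler_wpM2l (ltW (P0 x))).
have -> : P x * (expR (g x) / (P x / Q x) / c) = Q x * expR (g x) / c.
  by field; rewrite !gt_eqF.
lra.
Qed.

Lemma kl_ge0 P Q : (forall x, 0 < P x) -> (forall x, 0 < Q x) ->
  \sum_x P x = 1 -> \sum_x Q x = 1 -> 0 <= kl P Q.
Proof.
move=> P0 Q0 P1 Q1; have := @donsker_varadhan P Q (fun=> 0) 1 P0 Q0 P1 ltr01.
rewrite big1; last by move=> x _; rewrite mulr0.
under eq_bigr do rewrite expR0 mulr1.
by rewrite Q1 ln1 divr1 addr0 addrK.
Qed.

(** Apply the previous bound to [g = ln M] times the indicator of [A i], so that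
[exp g] is [M] on [A i] and 1 elsewhere, and average over [i]. The events being
disjoint, the average of [E_Q (exp g)] is at most [1 + (M - 1) / M < 2], which
is why the tangent is taken at [c = 2]. *)
Lemma fano (M : nat) (P : 'I_M -> T -> R) Q (A : 'I_M -> pred T) (K : R) :
  (0 < M)%N ->
  (forall i x, 0 < P i x) -> (forall x, 0 < Q x) ->
  (forall i, \sum_x P i x = 1) -> \sum_x Q x = 1 ->
  (forall i, kl (P i) Q <= K) ->
  (forall i j x, A i x -> A j x -> i = j) ->
  ln M%:R * \sum_i \sum_(x | A i x) P i x <= M%:R * (K + ln 2).
Proof.
move=> M0 P0 Q0 P1 Q1 klK Adisj.
have M0' : (0 : R) < M%:R by rewrite ltr0n.
have M1 : (1 : R) <= M%:R by rewrite ler1n.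
have step i : ln M%:R * (\sum_(x | A i x) P i x) <=
    K + ln 2 + (1 + (M%:R - 1) * \sum_(x | A i x) Q x) / 2 - 1.
  have := @donsker_varadhan (P i) Q (fun x => ln M%:R * (A i x)%:R) 2
    (P0 i) Q0 (P1 i) (ltr0n _ 2).
  have -> : \sum_x P i x * (ln M%:R * (A i x)%:R) =
      ln M%:R * \sum_(x | A i x) P i x.
    rewrite [in RHS]big_mkcond mulr_sumr; apply: eq_bigr => x _.
    by case: (A i x) => /=; ring.
  have -> : \sum_x Q x * expR (ln M%:R * (A i x)%:R) =
      1 + (M%:R - 1) * \sum_(x | A i x) Q x.
    rewrite [in RHS]big_mkcond mulr_sumr -[X in _ = X + _]Q1 -big_split.
    apply: eq_bigr => x _ /=; case: (A i x) => /=.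
      by rewrite mulr1 lnK ?posrE //; ring.
    by rewrite !mulr0 expR0 mulr1 addr0.
  move=> h; apply: le_trans h _; have := klK i; lra.
have disj : \sum_i \sum_(x | A i x) Q x <= 1.
  rewrite -Q1 (exchange_big_dep xpredT) //=; apply: ler_sum => x _.
  rewrite -[leRHS]mulr1n sumr_const; apply: ler_wpMn2l; first exact: ltW.
  apply/card_le1_eqP => i j Ai Aj; exact: Adisj Aj Ai.
rewrite mulr_sumr; apply: le_trans (ler_sum _ (fun i _ => step i)) _.
rewrite sumrB big_split /= !sumr_const card_ord -mulr_suml big_split /=.
rewrite sumr_const card_ord -mulr_sumr -[(K + ln 2) *+ M]mulr_natl.
have : 0 <= (M%:R - 1) * (1 - \sum_i \sum_(x | A i x) Q x).
  by rewrite mulr_ge0 ?subr_ge0.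
lra.
Qed.
End Fano.

(** Greedy choice: a separated family with fewer than [k] elements is not a
cover, so that some point of [A] is far from all of them. *)
Lemma separated_family (R : realType) (V : zmodType) (A : set V)
    (nrm : V -> R) (eps : R) (k : nat) : nrm 0 <= eps ->
  (forall j N, (j < k)%N -> is_cover A nrm eps N -> ~ (N #= `I_j)%card) ->
  exists f : nat -> V, (forall i, (i < k)%N -> A (f i)) /\
    forall i j, (i < j < k)%N -> eps < nrm (f i - f j).
Proof.
move=> nrm0; elim: k => [|k IHk] nocover.
  by exists (fun=> 0); split => // i j; rewrite ltn0 andbF.
have [|f [fA fsep]] := IHk.
  by move=> j N jk; apply: nocover; exact: ltnW.
have finj : {in `I_k &, injective f}.
  move=> i j; rewrite !inE /= => ik jk fij; case: (ltngtP i j) => // ij.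
    by have := fsep i j; rewrite ij jk fij subrr ltNge nrm0 => /(_ isT).
  by have := fsep j i; rewrite ij ik fij subrr ltNge nrm0 => /(_ isT).
have [v Av vfar] : exists2 v, A v & forall i, (i < k)%N -> eps < nrm (f i - v).
  apply: contrapT => /forall2NP nv.
  apply: (nocover k (f @` `I_k)) (ltnSn k) _ (inj_card_eq finj).
  split; first by move=> _ [i ik <-]; exact: fA.
  move=> v Av; have [//|] := nv v.
  move/existsNP => [i /not_implyP[ik /negP]]; rewrite -leNgt => h.
  by exists (f i) => //; exists i.
exists (fun i => if i == k then v else f i); split.
  move=> i; rewrite ltnS leq_eqVlt; case: eqVneq => //= _; exact: fA.
move=> i j /andP[ij jk]; have ik : (i < k)%N by exact: leq_trans ij _.
rewrite (ltn_eqF ik); case: eqVneq => [_|nejk]; first exact: vfar.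
by apply: fsep; rewrite ij ltn_neqAle nejk.
Qed.

(** * The minimax lower bound *)

(** Adding the reverse divergence, which is nonnegative, makes the partition
functions cancel, and leaves a difference of mean energies. *)
Lemma kl_ising_le (R : realType) (n : nat) (alpha : R) (A B : 'M[R]_n) :
  0 < alpha -> alpha < 1 ->
  interaction_matrix A -> interaction_matrix B ->
  norm_inf A <= 1 - alpha -> norm_inf B <= 1 - alpha ->
  kl (ising_prob A) (ising_prob B) <= norm_F (A - B) ^+ 2 / alpha ^+ 2.
Proof.
move=> a0 a1 HA HB Ainf Binf.
apply: le_trans (energy_increment a0 a1 HA HB Ainf Binf).
have BA0 := kl_ge0 (ising_prob_gt0 B) (ising_prob_gt0 A)
  (ising_prob_sum1 B) (ising_prob_sum1 A).
pose c := ln (\sum_x ising_weight B x) - ln (\sum_x ising_weight A x).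
have posw (J : 'M[R]_n) x : ising_weight J x \is Num.pos.
  by rewrite posrE ising_weight_gt0.
have posZ (J : 'M[R]_n) : \sum_x ising_weight J x \is Num.pos.
  by rewrite posrE partition_gt0.
have posP (J : 'M[R]_n) x : ising_prob J x \is Num.pos.
  by rewrite posrE ising_prob_gt0.
have lnP (J : 'M[R]_n) x :
    ln (ising_prob J x) = energy J x - ln (\sum_y ising_weight J y).
  rewrite [LHS](ln_div (posw J x) (posZ J)); congr (_ - _); exact: expRK.
have energyB x : energy A x - energy B x = energy (A - B) x.
  by have := energyD A B x (-1); rewrite scaleN1r mulN1r.
have lnAB x : ln (ising_prob A x / ising_prob B x) = energy (A - B) x + c.
  by rewrite ln_div // !lnP -energyB /c; ring.
have lnBA x : ln (ising_prob B x / ising_prob A x) = - (energy (A - B) x + c).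
  by rewrite ln_div // !lnP -energyB /c; ring.
have -> : ising_expectation A (energy (A - B)) =
    kl (ising_prob A) (ising_prob B) - c.
  rewrite /kl; under [in RHS]eq_bigr do rewrite lnAB mulrDr.
  by rewrite big_split /= -mulr_suml ising_prob_sum1 mul1r addrK.
have -> : ising_expectation B (energy (A - B)) =
    - kl (ising_prob B) (ising_prob A) - c.
  rewrite /kl -sumrN; under [in RHS]eq_bigr do rewrite lnBA mulrN opprK mulrDr.
  by rewrite big_split /= -mulr_suml ising_prob_sum1 mul1r addrK.
lra.
Qed.

Lemma norm_FN (R : realType) (n : nat) (A : 'M[R]_n) :
  norm_F (- A) = norm_F A.
Proof.
rewrite /norm_F; congr Num.sqrt.
by do 2! (apply: eq_bigr => ? _); rewrite mxE sqrrN.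
Qed.

Lemma norm_F_ge0 (R : realType) (n : nat) (A : 'M[R]_n) : 0 <= norm_F A.
Proof. exact: sqrtr_ge0. Qed.

(** Instead of the triangle inequality, the parallelogram bound
[|A + B|^2 <= 2 (|A|^2 + |B|^2)] is enough for two vectors in the same ball. *)
Lemma norm_FD_lt (R : realType) (n : nat) (A B : 'M[R]_n) (r : R) :
  norm_F A < r -> norm_F B < r -> norm_F (A + B) < 2 * r.
Proof.
move=> Ar Br; have := norm_F_ge0 A; have := norm_F_ge0 B.
have : norm_F (A + B) ^+ 2 <= 2 * (norm_F A ^+ 2 + norm_F B ^+ 2).
  rewrite !norm_F_sqr -big_split mulr_sumr; apply: ler_sum => i _ /=.
  rewrite -big_split mulr_sumr; apply: ler_sum => j _ /=.
  by rewrite mxE; have := sqr_ge0 (A i j - B i j); nra.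
have := norm_F_ge0 (A + B); nra.
Qed.

Lemma cover_card_ge (R : realType) (V : zmodType) (A : set V)
    (nrm : V -> R) (eps beta : R) (k : nat) (N : set V) :
  (beta%:E <= (2^-1)%:E * lne (covering_number A nrm eps))%E ->
  is_cover A nrm eps N -> (N #= `I_k)%card -> expR (2 * beta) <= k%:R.
Proof.
move=> hbeta covN cardN.
have cov_le : (covering_number A nrm eps <= (k%:R : R)%:E)%E.
  by apply: ge_ereal_inf; exists (k%:R : R)%:E => //; exists k => //; exists N.
have cov_ge0 : (0 <= covering_number A nrm eps)%E.
  by apply/ereal_infP => _ [m _ <-]; rewrite lee_fin ler0n.
have lne_le : (lne (covering_number A nrm eps) <= lne (k%:R : R)%:E)%E.
  by rewrite lee_lne // in_itv /= ?leey ?andbT // lee_fin ler0n.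
have half0 : (0 <= (2^-1 : R)%:E)%E by rewrite lee_fin invr_ge0.
have {lne_le} := le_trans hbeta (lee_wpmul2l half0 lne_le).
have [->|k0] := posnP k.
  by rewrite le0_lneNy // gt0_muleNy ?lte_fin ?invr_gt0 // leeNy_eq.
have k0' : (0 : R) < k%:R by rewrite ltr0n.
rewrite lne_EFin // -EFinM lee_fin => h.
by rewrite -[leRHS]lnK ?posrE // ler_expR; lra.
Qed.

(** Markov's inequality, for the complement of the event [g x < r]. *)
Lemma markov_expectation (R : realType) (n : nat) (J : 'M[R]_n) (r : R)
    (g : {ffun 'I_n -> bool} -> R) : (forall x, 0 <= g x) ->
  r * (1 - \sum_(x | g x < r) ising_prob J x) <= ising_expectation J g.
Proof.
move=> g0; rewrite -(ising_prob_sum1 J) [X in _ - X]big_mkcond -sumrB mulr_sumr.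
apply: ler_sum => x _; have px := ising_prob_gt0 J x; have gx := g0 x.
case: ltP => h /=.
  by rewrite subrr mulr0; apply: mulr_ge0 => //; exact: ltW.
by rewrite subr0 mulrC ler_pM2l.
Qed.

Unset Implicit Arguments.

Theorem theorem2 (R : realType) (alpha : R) (alpha_gt0 : 0 < alpha)
    (alpha_lt1 : alpha < 1) :
  exists C : R,
    forall (n : nat) (r D : R) (F : set 'M[R]_n),
      0 < r -> 0 < D ->
      (forall J, F J -> interaction_matrix J) ->
      (forall J, F J -> norm_inf J <= 1 - alpha) ->
      (forall A B, F A -> F B -> norm_F (A - B) <= D) ->
      ((C * D ^+ 2 + ln 2)%:E
         <= (2^-1)%:E * lne (covering_number F (@norm_F R n) (2 * r)))%E ->
      forall Jhat : {ffun 'I_n -> bool} -> 'M[R]_n,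
        ((r / 2)%:E <=
          ereal_sup [set (ising_expectation J
                           (fun x => norm_F (Jhat x - J)))%:E | J in F])%E.
Proof.
exists (alpha ^- 2) => n r D F r0 D0 Fint Finf Fdiam hcov Jhat.
set beta := _ + ln 2 in hcov.
(* M is the least integer above the threshold, so that no smaller number of
   points covers F. *)
have [M hM Mmin] : exists2 M : nat, expR (2 * beta) <= M%:R &
    forall k, (k < M)%N -> k%:R < expR (2 * beta).
  have exM : exists M : nat, expR (2 * beta) <= M%:R.
    exists (Num.bound (expR (2 * beta))).
    by rewrite ltW // archi_boundP ?expR_ge0.
  case: (ex_minnP exM) => M hM Mmin; exists M => // k kM.
  by rewrite ltNge; apply/negP => /Mmin; rewrite leqNgt kM.
have M0 : (0 < M)%N.
  by rewrite -(ltr0n R); apply: lt_le_trans hM; exact: expR_gt0.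
have [f [fF fsep]] : exists f : nat -> 'M[R]_n,
    (forall i, (i < M)%N -> F (f i)) /\
    forall i j, (i < j < M)%N -> 2 * r < norm_F (f i - f j).
  apply: (@separated_family _ _ F).
    rewrite /norm_F big1 ?sqrtr0 ?mulr_ge0 ?ltW // => i _.
    by rewrite big1 // => j _; rewrite mxE expr0n.
  move=> j N /Mmin jlt covN cardN.
  by have := cover_card_ge hcov covN cardN; rewrite leNgt jlt.
rewrite leNgt; apply/negP => sup_lt.
have risk_lt (i : 'I_M) :
    ising_expectation (f i) (fun x => norm_F (Jhat x - f i)) < r / 2.
  rewrite -lte_fin; apply: le_lt_trans sup_lt; apply: ereal_sup_ubound.
  by exists (f i) => //; exact: fF.
(* The events on which the estimate is decoded as the i-th model. *)
pose near (i : 'I_M) (x : {ffun 'I_n -> bool}) := norm_F (Jhat x - f i) < r.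
have near_inj i j x : near i x -> near j x -> i = j.
  have far (k l : 'I_M) : (k < l)%N -> near k x -> near l x -> False.
    move=> kl kx lx; have := fsep k l; rewrite kl ltn_ord => /(_ isT).
    apply/negP; rewrite -leNgt ltW //.
    have -> : f k - f l = - (Jhat x - f k) + (Jhat x - f l).
      by rewrite opprB addrA subrK.
    by apply: norm_FD_lt; rewrite ?norm_FN.
  move=> ix jx; apply/val_inj; case: (ltngtP (val i) (val j)) => //.
    by move=> /far /(_ ix jx).
  by move=> /far /(_ jx ix).
(* The common reference law is the first model. *)
have := @fano R _ M (fun i => ising_prob (f i)) (ising_prob (f 0%N)) near
  (alpha ^- 2 * D ^+ 2) M0 (fun i => ising_prob_gt0 (f i))
  (ising_prob_gt0 (f 0%N)) (fun i => ising_prob_sum1 (f i))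
  (ising_prob_sum1 (f 0%N)) _ near_inj.
have klD (i : 'I_M) : kl (ising_prob (f i)) (ising_prob (f 0%N)) <=
    alpha ^- 2 * D ^+ 2.
  have Fi := fF i (ltn_ord i); have F0 := fF 0%N M0.
  apply: le_trans (kl_ising_le alpha_gt0 alpha_lt1 (Fint _ Fi) (Fint _ F0)
    (Finf _ Fi) (Finf _ F0)) _.
  rewrite mulrC ler_pM2l ?invr_gt0 ?exprn_gt0 //.
  have := Fdiam _ _ Fi F0; have := norm_F_ge0 (f i - f 0%N); nra.
move=> /(_ klD); rewrite -/beta; set S := \sum_i _ => fanoS.
have M0' : (0 : R) < M%:R by rewrite ltr0n.
have lnM : 2 * beta <= ln M%:R.
  by rewrite -[leLHS]expRK ler_ln // posrE ?expR_gt0.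
have beta0 : 0 < beta.
  by rewrite ltr_wpDl ?ln_gt0 ?ltr1n // mulr_ge0 ?sqr_ge0 // invr_ge0 sqr_ge0.
have S_le : S <= M%:R / 2.
  rewrite -(@ler_pM2l _ (ln M%:R)); last by lra.
  apply: le_trans fanoS _; nra.
have : r * (M%:R - S) < M%:R * (r / 2); last by nra.
have <- : \sum_(i < M) r * (1 - \sum_(x | near i x) ising_prob (f i) x) =
    r * (M%:R - S).
  by rewrite -mulr_sumr sumrB sumr_const card_ord.
rewrite mulr_natl -[M in _ *+ M]card_ord -sumr_const.
apply: ltr_sum.
  by apply/hasP; exists (Ordinal M0); rewrite ?mem_index_enum.
move=> i _; apply: le_lt_trans (risk_lt i).
by apply: markov_expectation => x; exact: norm_F_ge0.
Qed.
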